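(* Let $R = k[X_1,\ldots,X_n]$ be a polynomial ring over a field $k$ (in any number $n$ of variables) and let $J \subset R$ be an ideal of height two that can be generated by three elements. If the unmixed part $J^{\mathrm{unm}}$ of $J$ contains a linear form, then $\operatorname{pd}_R(R/J) \leq 3$.
   Context: A linear form is a nonzero homogeneous polynomial of degree $1$. The unmixed part $J^{\mathrm{unm}}$ of an ideal $J$ in a Noetherian ring is the intersection of those primary components $Q$ of $J$ (in a primary decomposition) with $\operatorname{ht}(Q) = \operatorname{ht}(J)$, where $\operatorname{ht}$ denotes height. $\operatorname{pd}_R$ denotes projective dimension over $R$. *)

(* Defs.v *)
(* MathComp and multinomials. *)
From HB Require Import structures.
From mathcomp Require Import all_boot all_order all_algebra.
From mathcomp Require Import ring_quotient.
From mathcomp.multinomials Require Export mpoly.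

Set Implicit Arguments.
Unset Strict Implicit.
Unset Printing Implicit Defensive.

Import GRing.Theory.
Local Open Scope ring_scope.
Local Open Scope quotient_scope.

(* A proper ideal of R is an [idealr R], a prime ideal is a [prime_idealr R]. *)

Section Ideals.
Variable R : comNzRingType.

Definition generated_by (m : nat) (f : 'I_m -> R) (J : {pred R}) : Prop :=
  forall x, x \in J <-> exists a : 'I_m -> R, x = \sum_i a i * f i.

(* The exponent m = 0 is harmless, since Q is proper. *)
Definition primary (Q : idealr R) : Prop :=
  forall u v, u * v \in Q -> u \in Q \/ exists m : nat, v ^+ m \in Q.

(* ht P >= d: some chain p 0 < p 1 < ... < p d of primes ends at p d = P.
   The values p i for i > d are irrelevant. *)
Definition prime_height_ge (P : prime_idealr R) (d : nat) : Prop :=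
  exists p : nat -> prime_idealr R,
    [/\ forall i, (i < d)%N -> {subset p i <= p i.+1},
        forall i, (i < d)%N -> ~ {subset p i.+1 <= p i}
      & p d =i P].

(* ht I is the infimum of the heights of the primes containing I. *)
Definition height_ge (I : idealr R) (d : nat) : Prop :=
  forall P : prime_idealr R, {subset I <= P} -> prime_height_ge P d.

Definition has_height (I : idealr R) (d : nat) : Prop :=
  height_ge I d /\ ~ height_ge I d.+1.

(* ht I = ht J, as elements of {0, 1, ..., oo}. *)
Definition same_height (I J : idealr R) : Prop :=
  forall d, height_ge I d <-> height_ge J d.

Definition primary_decomposition (m : nat) (Q : 'I_m -> idealr R)
    (J : idealr R) : Prop :=
  (forall i, primary (Q i)) /\ (forall x, x \in J <-> forall i, x \in Q i).

(* In a Noetherian ring the components of height ht J belong to minimal primes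
   of J, so their intersection is the same for every primary decomposition of
   J, irredundant or not. *)
Definition unmixed_part (J : idealr R) (x : R) : Prop :=
  exists (m : nat) (Q : 'I_m -> idealr R),
    primary_decomposition Q J /\
    (forall i, same_height (Q i) J -> x \in Q i).

End Ideals.

Section QuotientModule.
Variables (R : comNzRingType) (J : idealr R).

Definition quot_scale (a : R) (x : {ideal_quot J}) : {ideal_quot J} :=
  \pi_({ideal_quot J}) a * x.

Fact quot_scaleA a b x : quot_scale a (quot_scale b x) = quot_scale (a * b) x.
Proof. by rewrite /quot_scale rmorphM mulrA. Qed.

Fact quot_scale1 : left_id 1 quot_scale.
Proof. by move=> x; rewrite /quot_scale rmorph1 mul1r. Qed.

Fact quot_scaleDr : right_distributive quot_scale +%R.
Proof. by move=> a x y; rewrite /quot_scale mulrDr. Qed.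

Fact quot_scaleDl x : {morph quot_scale^~ x : a b / a + b}.
Proof. by move=> a b; rewrite /quot_scale rmorphD mulrDl. Qed.

HB.instance Definition _ := GRing.Zmodule_isLmodule.Build R {ideal_quot J}
  quot_scaleA quot_scale1 quot_scaleDr quot_scaleDl.

End QuotientModule.

Section ProjectiveDimension.
Variable R : nzRingType.

Definition projective (P : lmodType R) : Prop :=
  forall (M N : lmodType R) (g : {linear M -> N}) (f : {linear P -> N}),
    (forall y, exists x, g x = y) ->
    exists h : {linear P -> M}, forall x, g (h x) = f x.

(* pd M <= d: there is an exact sequence
     ... -> P 2 -> P 1 -> P 0 -> M -> 0
   with all P i projective and P i = 0 for i > d. *)
Definition projdim_le (M : lmodType R) (d : nat) : Prop :=
  exists (P : nat -> lmodType R) (del : forall i, {linear P i.+1 -> P i})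
         (eps : {linear P 0%N -> M}),
    [/\ forall i, projective (P i),
        forall i, (d < i)%N -> forall x : P i, x = 0,
        forall y, exists x, eps x = y,
        forall x, eps x = 0 <-> exists y, del 0%N y = x
      & forall i x, del i x = 0 <-> exists y, del i.+1 y = x].

End ProjectiveDimension.

Definition linear_form (n : nat) (k : fieldType) (l : {mpoly k[n]}) : Prop :=
  l != 0 /\ l \is 1.-homog.

(* Main.v *)
(* Let [l] be a linear form in the unmixed part of [J = (f_0, f_1, f_2)].  Modulo
   [l] the ring is again a polynomial ring, hence a GCD domain, so
   [f_i = a_i l + b_i g] where the [b_i] have no common factor modulo [l].  Then
   [R / J] is resolved by the Buchsbaum-Rim complex of the 2x4 matrix [M] with
   columns [(a_i, b_i)] and [(-g, l)], truncated to
   [0 -> R^2 -> R^4 -> R^3 -> R], as soon as the ideal of 2x2 minors of [M]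
   contains a regular sequence of length three: every minor acts on the complex
   as a null-homotopic map.

   Heights enter only through algebraic dependence.  An ideal [I] of [k[n]] has
   [codim_ge I d] if [I] meets every subring generated by more than [n - d]
   elements in the value of a nonzero polynomial.  Ideals of height at least [d]
   that are primary have this property, as do ideals containing a regular
   sequence of length [d]; conversely such an ideal contains a regular sequence
   of length [d], by Nagata's change of variables.  For the ideal of minors, two
   conditions combine: [s l] is in [J] for suitable [s], which gives a column
   combination [(s, 0)], and the coprimality of the [b_i] gives [( *, s')], so
   that [s s'] is a combination of minors. *)

Require Import Defs.
From HB Require Import structures.
From mathcomp Require Import all_boot all_order all_algebra.
From mathcomp Require Import ring_quotient.
From mathcomp.multinomials Require Import mpoly.
From mathcomp Require Import zify ring.
From Stdlib Require Import Classical ClassicalEpsilon.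

Set Implicit Arguments.
Unset Strict Implicit.
Unset Printing Implicit Defensive.

Import GRing.Theory.
Local Open Scope ring_scope.
Local Open Scope quotient_scope.

(** * Splitting off a variable *)

Lemma mpoly_morph_ext (R : comNzRingType) (n : nat) (S : comNzRingType)
    (phi psi : {rmorphism {mpoly R[n]} -> S}) :
  (forall c, phi c%:MP = psi c%:MP) -> (forall i, phi 'X_i = psi 'X_i) ->
  phi =1 psi.
Proof.
move=> eqC eqX p; rewrite [p]mpolyE !raddf_sum /=; apply: eq_bigr => m _.
rewrite -mul_mpolyC !rmorphM /= eqC mpolyXE_id !rmorph_prod; congr (_ * _).
by apply: eq_bigr => i _; rewrite !rmorphXn /= eqX.
Qed.

Lemma poly_morph_ext (R S : comNzRingType) (phi psi : {rmorphism {poly R} -> S}) :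
  (forall c, phi c%:P = psi c%:P) -> phi 'X = psi 'X -> phi =1 psi.
Proof.
move=> eqC eqX; elim/poly_ind => [|p c IH]; first by rewrite !rmorph0.
by rewrite !rmorphD !rmorphM /= IH eqC eqX.
Qed.

Section ShearedSplitting.
Variables (k : fieldType) (n : nat) (w : 'I_n -> nat) (j : 'I_n.+1).

(** Nagata's triangular change of coordinates. With all weights zero it is the plain splitting, up
    to translating the remaining variables by ['X^0], that is by 1. *)
Definition split_var (i : 'I_n.+1) : {poly {mpoly k[n]}} :=
  if unlift j i is Some i' then ('X_i')%:P + 'X^(w i') else 'X.

Definition split_poly : {mpoly k[n.+1]} -> {poly {mpoly k[n]}} :=
  mmap (polyC \o @mpolyC n k) split_var.
HB.instance Definition _ := GRing.RMorphism.on split_poly.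

Definition join_coef : {mpoly k[n]} -> {mpoly k[n.+1]} :=
  mmap (@mpolyC n.+1 k) (fun i => 'X_(lift j i) - 'X_j ^+ w i).
HB.instance Definition _ := GRing.RMorphism.on join_coef.

Definition join_poly : {poly {mpoly k[n]}} -> {mpoly k[n.+1]} :=
  horner_eval ('X_j) \o map_poly join_coef.
HB.instance Definition _ := GRing.RMorphism.on join_poly.

Lemma split_polyC c : split_poly c%:MP = (c%:MP)%:P.
Proof. by rewrite /split_poly mmapC. Qed.

Lemma split_polyX i : split_poly 'X_i = split_var i.
Proof. by rewrite /split_poly mmapX mmap1U. Qed.

Lemma split_polyXj : split_poly 'X_j = 'X.
Proof. by rewrite split_polyX /split_var unlift_none. Qed.

Lemma split_polyXlift i : split_poly 'X_(lift j i) = ('X_i)%:P + 'X^(w i).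
Proof. by rewrite split_polyX /split_var liftK. Qed.

Lemma join_coefC c : join_coef c%:MP = c%:MP.
Proof. by rewrite /join_coef mmapC. Qed.

Lemma join_coefX i : join_coef 'X_i = 'X_(lift j i) - 'X_j ^+ w i.
Proof. by rewrite /join_coef mmapX mmap1U. Qed.

Lemma join_polyC a : join_poly a%:P = join_coef a.
Proof. by rewrite /join_poly /= map_polyC /horner_eval hornerC. Qed.

Lemma join_polyX : join_poly 'X = 'X_j.
Proof. by rewrite /join_poly /= map_polyX /horner_eval hornerX. Qed.

Lemma split_polyK : cancel split_poly join_poly.
Proof.
apply: (mpoly_morph_ext (phi := join_poly \o split_poly) (psi := idfun)) => [c|i] /=.
  by rewrite split_polyC join_polyC join_coefC.
case: (unliftP j i) => [i'|] ->.
  by rewrite split_polyXlift rmorphD rmorphXn /= join_polyX join_polyC join_coefX subrK.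
by rewrite split_polyXj join_polyX.
Qed.

Lemma split_join_coef a : split_poly (join_coef a) = a%:P.
Proof.
move: a; apply: (mpoly_morph_ext (phi := split_poly \o join_coef) (psi := polyC)) => [c|i] /=.
  by rewrite join_coefC split_polyC.
by rewrite join_coefX rmorphB rmorphXn /= split_polyXj split_polyXlift addrK.
Qed.

Lemma join_polyK : cancel join_poly split_poly.
Proof.
apply: (poly_morph_ext (phi := split_poly \o join_poly) (psi := idfun)) => [c|] /=.
  by rewrite join_polyC split_join_coef.
by rewrite join_polyX split_polyXj.
Qed.

End ShearedSplitting.

(** * Algebraic dependence and codimension *)

Local Notation peval r := (mmap (@mpolyC _ _) r).

Lemma msize_prod_le (k : fieldType) (n : nat) (I : finType)
    (F : I -> {mpoly k[n]}) (a : I -> nat) :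
  (forall i, msize (F i) <= (a i).+1)%N ->
  (msize (\prod_i F i) <= (\sum_i a i).+1)%N.
Proof.
move=> leF; elim/big_rec2: _ => [|i s p _ IH]; first by rewrite msize1.
have [->|Fi0] := eqVneq (F i) 0; first by rewrite mul0r msize0.
have [->|p0] := eqVneq p 0; first by rewrite mulr0 msize0.
rewrite msizeM //; have /= := leF i; move: (msize _) (msize _) IH => x y; lia.
Qed.

(** Counting: there are more monomials in the [r i] with all exponents below [d] than ambient
    monomials in which they can be expanded, so some linear relation holds between them. *)
Lemma alg_dependent (k : fieldType) (n m : nat) (r : 'I_m -> {mpoly k[n]}) :
  (n < m)%N -> exists2 G : {mpoly k[m]}, G != 0 & peval r G = 0.
Proof.
move=> ltnm; pose D := (\sum_i msize (r i))%N.
(* [D] bounds the degree of each [r i], and [N] exceeds the degree of every product considered. The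
   choice of [d] gives [N ^ n < d ^ n.+1 <= d ^ m]. *)
pose d := ((m * D).+1 ^ n).+1; pose N := (m * (d * D)).+1.
pose I : finType := {ffun 'I_m -> 'I_d}; pose T : finType := {ffun 'I_n -> 'I_N}.
have ltTI : (#|T| < #|I|)%N.
  rewrite !card_ffun !card_ord.
  have leX a b e : (a <= b -> a ^ e <= b ^ e)%N.
    by case: e => // e leab; rewrite leq_exp2r.
  have leN : (N <= d * (m * D).+1)%N by rewrite /N /d; nia.
  apply: (@leq_ltn_trans (d ^ n * (m * D).+1 ^ n)).
    by rewrite -expnMn leX.
  apply: (@leq_trans (d ^ n.+1)); last by rewrite leq_pexp2l.
  by rewrite expnSr ltn_pmul2l ?expn_gt0.
pose monI (e : I) := [multinom (e i : nat) | i < m].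
pose monT (e : T) := [multinom (e i : nat) | i < n].
pose img (e : I) := \prod_i r i ^+ e i.
pose M : 'M[k]_(#|I|, #|T|) := \matrix_(a, b) (img (enum_val a))@_(monT (enum_val b)).
have /rowV0Pn[v /sub_kermxP vM v0] : kermx M != 0.
  by rewrite kermx_eq0 /row_free neq_ltn (leq_ltn_trans (rank_leq_col M)).
pose G := \sum_a v 0 a *: 'X_[monI (enum_val a)] : {mpoly k[m]}.
exists G.
  case/rV0Pn: v0 => a va; apply: contraNneq va => G0.
  have := congr1 (mcoeff (monI (enum_val a))) G0.
  rewrite mcoeff0 raddf_sum (bigD1 a) //= mcoeffZ mcoeffX eqxx mulr1 big1 ?addr0 => [->//|].
  move=> b neq_ba; rewrite mcoeffZ mcoeffX.
  case: eqP => [/mnmP e|]; last by rewrite mulr0.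
  case/eqP: neq_ba; apply: enum_val_inj; apply/ffunP=> i; apply: val_inj.
  by have := e i; rewrite !mnmE.
have -> : peval r G = \sum_a v 0 a *: img (enum_val a).
  rewrite raddf_sum; apply: eq_bigr => a _ /=.
  rewrite mmapZ mmapX mul_mpolyC; congr (_ *: _).
  by apply: eq_bigr => i _; rewrite mnmE.
apply/mpolyP => mu; rewrite mcoeff0 raddf_sum /=.
(* Exponents below [N] index a column of [M], where [vM] applies; any other monomial has too large a
   degree to occur in a product [img]. *)
have [/forallP lt_mu|/forallPn[i0]] := boolP [forall i, mu i < N]%N.
  pose e : T := [ffun i => Ordinal (lt_mu i)].
  have := congr1 (fun A : 'rV_#|T| => A 0 (enum_rank e)) vM.
  rewrite !mxE => {2}<-; apply: eq_bigr => a _; rewrite mcoeffZ mxE enum_rankK.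
  by congr (_ * mcoeff _ _); apply/mnmP => i; rewrite mnmE ffunE.
rewrite -leqNgt => leNi; apply: big1 => a _; rewrite mcoeffZ.
rewrite (@memN_msupp_eq0 _ _ _ mu) ?mulr0 //; apply/negP => /msize_mdeg_lt.
apply/negP; rewrite -leqNgt.
have : (msize (img (enum_val a)) <= (\sum_(i < m) d * D).+1)%N.
  apply: msize_prod_le => i.
  have -> : r i ^+ enum_val a i = \prod_(j < enum_val a i) r i.
    by rewrite prodr_const card_ord.
  apply: leq_trans (@msize_prod_le _ _ _ _ (fun=> D) _) _ => [j|].
    by apply: leqW; rewrite /D (bigD1 i) //= leq_addr.
  by rewrite sum_nat_const card_ord ltnS leq_mul2r ltnW ?orbT // ltn_ord.
rewrite sum_nat_const card_ord => /leq_trans; apply; apply: leq_trans leNi _.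
by rewrite mdegE (bigD1 i0) //= leq_addr.
Qed.

(** * Ideals as predicates and regular sequences *)

Section Ideal.
Variable R : comNzRingType.
Implicit Types (I : R -> Prop) (x u v : R).

(** Unlike [idealr], this allows the unit ideal, which may occur as an ideal of minors or along a
    regular sequence. *)
Record ideal_pred I : Prop := IdealPred {
  ideal_pred0 : I 0;
  ideal_predD : forall u v, I u -> I v -> I (u + v);
  ideal_predM : forall a u, I u -> I (a * u) }.

Lemma ideal_predN I u : ideal_pred I -> I u -> I (- u).
Proof. by move=> idI Iu; rewrite -mulN1r; apply: ideal_predM. Qed.

Lemma ideal_predB I u v : ideal_pred I -> I u -> I v -> I (u - v).
Proof. by move=> idI Iu Iv; apply: ideal_predD => //; apply: ideal_predN. Qed.

Lemma ideal_predMr I a u : ideal_pred I -> I u -> I (u * a).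
Proof. by move=> idI Iu; rewrite mulrC; apply: ideal_predM. Qed.

Lemma ideal_pred_sum I (T : Type) (r : seq T) (P : pred T) (F : T -> R) :
  ideal_pred I -> (forall i, P i -> I (F i)) -> I (\sum_(i <- r | P i) F i).
Proof.
by move=> idI IF; apply: big_ind => //; [apply: ideal_pred0|apply: ideal_predD].
Qed.

Lemma zero_ideal_pred : ideal_pred (fun u : R => u = 0).
Proof. by split => // [u v ->->|a u ->]; rewrite ?addr0 ?mulr0. Qed.

Definition ideal_add I x u := exists a, I (u - a * x).

Lemma ideal_add_pred I x : ideal_pred I -> ideal_pred (ideal_add I x).
Proof.
move=> idI; split => [|u v [a Ia] [b Ib]|c u [a Ia]].
- by exists 0; rewrite mul0r subr0; apply: ideal_pred0.
- by exists (a + b); rewrite mulrDl opprD addrACA; apply: ideal_predD.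
- by exists (c * a); rewrite -mulrA -mulrBr; apply: ideal_predM.
Qed.

Definition nonzerodivisor_mod I x := forall u, I (x * u) -> I u.

(** The final quotient may vanish, so the unit ideal contains regular sequences of every length. *)
Fixpoint regular_seq I (s : seq R) : Prop :=
  if s is x :: s' then nonzerodivisor_mod I x /\ regular_seq (ideal_add I x) s'
  else True.

End Ideal.

Section Dependence.
Variables (k : fieldType) (n : nat).
Local Notation R := {mpoly k[n]}.

(* For an ideal, this says that the quotient has dimension at most [n - d]. *)
Definition codim_ge (I : R -> Prop) (d : nat) : Prop :=
  forall m (r : 'I_m -> R), (n < m + d)%N ->
  exists2 G : {mpoly k[m]}, G != 0 & I (peval r G).

Lemma codim_ge0 : codim_ge (fun u => u = 0) 0.
Proof. by move=> m r; rewrite addn0; apply: alg_dependent. Qed.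

Lemma peval_split (m : nat) (r : 'I_m -> R) (f : R) :
  exists r' : 'I_m.+1 -> R, forall G,
    peval r' G = (map_poly (peval r) (split_poly (fun=> 0%N) ord_max G)).[f].
Proof.
(* Adding 1 matches the translation by ['X^0] in the splitting of weight zero. *)
pose r' i := if unlift ord_max i is Some i' then r i' + 1 else f.
exists r'; pose psi := horner_eval f \o map_poly (peval r)
  \o split_poly (fun=> 0%N) (@ord_max m).
apply: (mpoly_morph_ext (phi := peval r') (psi := psi)) => [c|i] /=.
  by rewrite split_polyC map_polyC /= mmapC /horner_eval hornerC mmapC.
rewrite mmapX mmap1U split_polyX /split_var /r'; case: unlift => [i'|].
  rewrite expr0 rmorphD rmorph1 /= map_polyC /= mmapX mmap1U /horner_eval.
  by rewrite !hornerE.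
by rewrite map_polyX /horner_eval hornerX.
Qed.

(** With [f] adjoined to the [r i], some nonzero polynomial expression lies in [I]. Powers of [f]
    cancel modulo [I], and then the constant coefficient in [f] has its value in [I'], the other
    terms being multiples of [f]. *)
Lemma codim_ge_step (I I' : R -> Prop) (f : R) (d : nat) :
  ideal_pred I' -> (forall u, I u -> I' u) -> I' f -> nonzerodivisor_mod I f ->
  codim_ge I d -> codim_ge I' d.+1.
Proof.
move=> idI' sII' I'f regf codI m r ltnm.
have [r' r'E] := peval_split r f.
have [|G G0] := codI _ r'; first by lia.
rewrite r'E.
have : split_poly (fun=> 0%N) ord_max G != 0.
  by rewrite -(can_eq (split_polyK (fun=> 0%N) (ord_max : 'I_m.+1))) rmorph0 in G0 *.
move: (split_poly _ _ _) => {r' r'E G G0}.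
elim/poly_ind => [|p c IH]; first by rewrite eqxx.
have [->|c0 _] := eqVneq c 0.
  rewrite addr0 mulf_eq0 polyX_eq0 orbF => p0.
  by rewrite rmorphM /= map_polyX hornerM hornerX mulrC => /regf; apply: IH.
rewrite rmorphD rmorphM /= map_polyX map_polyC hornerD hornerM hornerX hornerC.
move=> /sII' Iu; exists c => //; rewrite -[peval r c](addKr ((map_poly (peval r) p).[f] * f)).
by rewrite addrC; apply: ideal_predB => //; apply: ideal_predM.
Qed.

End Dependence.

(** * Height and codimension *)

Section Heights.
Variables (k : fieldType) (n : nat).
Local Notation R := {mpoly k[n]}.

Lemma idealr_ideal_pred (I : idealr R) : ideal_pred (fun u => u \in I).
Proof.
by split => [|u v|a u]; [exact: rpred0|exact: rpredD|exact: idealMr].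
Qed.

(** Along the chain, an element of [p i.+1] outside the prime [p i] is a nonzerodivisor modulo
    [p i], so each link raises the codimension by one. *)
Lemma codim_ge_prime (P : prime_idealr R) d :
  prime_height_ge P d -> codim_ge (fun u => u \in P) d.
Proof.
case=> p [sub_p nsub_p pd] m r ltn; suff codp : forall i, (i <= d)%N -> codim_ge (fun u => u \in p i) i.
  by have [G G0 pG] := codp d (leqnn d) m r ltn; exists G; rewrite -?pd.
elim=> [_|i IH ltid].
  move=> m' r' ltn'; have [G G0 rG] := codim_ge0 r' ltn'.
  by exists G; rewrite // rG; apply: rpred0.
have [f pf npf] : exists2 f, f \in p i.+1 & f \notin p i.
  apply: NNPP => nex; apply: (nsub_p i ltid) => u pu.
  by apply/negPn/negP => npu; apply: nex; exists u.
apply: (codim_ge_step (f := f)) (IH (ltnW ltid)).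
- exact: idealr_ideal_pred.
- exact: sub_p.
- exact: pf.
- by move=> u; rewrite prime_idealrM (negPf npf).
Qed.

Section Radical.
Variables (Q : idealr R) (Qprimary : primary Q).

(** Made boolean by excluded middle, so that the radical can be declared as an [idealr]. *)
Definition radical : R -> bool :=
  fun u => if excluded_middle_informative (exists e, u ^+ e \in Q) then true else false.

Lemma radicalP u : reflect (exists e, u ^+ e \in Q) (u \in radical).
Proof.
by rewrite unfold_in /radical; case: excluded_middle_informative => ?; constructor.
Qed.

Lemma radical_idealr : idealr_closed radical.
Proof.
split=> [||a u v /radicalP[e ue] /radicalP[f vf]].
- by apply/radicalP; exists 1%N; rewrite expr1 rpred0.
- by apply/radicalP => -[e]; rewrite expr1n idealr1.
apply/radicalP; exists (e + f)%N; rewrite exprDn; apply: rpred_sum => i _.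
apply: rpredMn; have [lefi|ltif] := leqP f i.
  by rewrite -(subnK lefi) exprD mulrA; apply: idealMr.
have /subnK <- : (e <= e + f - i)%N by lia.
by rewrite exprD [(a * u) ^+ e]exprMn mulrAC !mulrA; apply: idealMr.
Qed.

Lemma radical_prime : prime_idealr_closed radical.
Proof.
move=> u v /radicalP[e]; rewrite exprMn => /Qprimary [uQ|[f vQ]]; apply/orP.
  by left; apply/radicalP; exists e.
by right; apply/radicalP; exists (e * f)%N; rewrite exprM.
Qed.

HB.instance Definition _ := isIdealr.Build R radical radical_idealr.
HB.instance Definition _ := isPrimeIdealrClosed.Build R radical radical_prime.

(** The radical is a prime containing [Q], and a power of a polynomial that works for the radical
    works for [Q]. *)
Lemma codim_ge_primary d : height_ge Q d -> codim_ge (fun u => u \in Q) d.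
Proof.
move=> htQ m r ltn; have sQ : {subset Q <= radical}.
  by move=> u Qu; apply/radicalP; exists 1%N.
have [G G0 /radicalP[e Ge]] := codim_ge_prime (htQ radical sQ) r ltn.
by exists (G ^+ e); rewrite ?rmorphXn ?expf_neq0.
Qed.

End Radical.

Lemma codim_ge_bigcap (I : finType) (A : pred I) (Q : I -> R -> Prop) d :
  (forall i, ideal_pred (Q i)) -> (forall i, A i -> codim_ge (Q i) d) ->
  codim_ge (fun u => forall i, A i -> Q i u) d.
Proof.
move=> idQ codQ m r ltn.
have /fin_all_exists2[G G0 QG] i : exists2 G : {mpoly k[m]}, G != 0 & A i -> Q i (peval r G).
  have [Ai|nAi] := boolP (A i); last by exists 1; rewrite ?oner_neq0.
  by have [G G0 QG] := codQ i Ai m r ltn; exists G.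
exists (\prod_i G i); first by rewrite prodf_seq_neq0; apply/allP => i _; apply/implyP.
by move=> i Ai; rewrite (bigD1 i) //= rmorphM /=; apply: ideal_predMr => //; apply: QG.
Qed.

Lemma prime_height_geS (P : prime_idealr R) d :
  prime_height_ge P d.+1 -> prime_height_ge P d.
Proof.
case=> p [sub_p nsub_p pd]; exists (fun i => p i.+1).
by split=> // i ltid; [apply: sub_p|apply: nsub_p].
Qed.

Lemma height_ge_le (I : idealr R) d d' : (d' <= d)%N -> height_ge I d -> height_ge I d'.
Proof.
move=> le htI P sIP; have := htI P sIP.
elim: d le {htI} => [|d IH]; first by rewrite leqn0 => /eqP ->.
by rewrite leq_eqVlt => /orP[/eqP->//|/IH ih /prime_height_geS].
Qed.

Lemma has_height_same_or_gt (I J : idealr R) d :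
  {subset J <= I} -> has_height J d -> same_height I J \/ height_ge I d.+1.
Proof.
move=> sJI [htJ nhtJ]; have [|nI] := classic (height_ge I d.+1); first by right.
left=> e; have [led|ltd] := leqP e d.
  split=> _; first exact: height_ge_le led htJ.
  by apply: height_ge_le led _ => P sIP; apply: htJ => u /sJI /sIP.
by split=> /(height_ge_le ltd).
Qed.

Section UnmixedPart.
Variables (J : idealr R) (d : nat).
Hypothesis htJ : has_height J d.

(* A component of [J] that does not contain [l] has height at least [d + 1]. *)
Lemma unmixed_part_codim l :
  unmixed_part J l -> codim_ge (fun s => s * l \in J) d.+1.
Proof.
case=> m [Q [[Qprim JQ] lQ]] m' r ltn.
pose A i := ~~ (if excluded_middle_informative (l \in Q i) then true else false).
have AP i : A i -> height_ge (Q i) d.+1.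
  rewrite /A; case: excluded_middle_informative => // nlQ _.
  case: (@has_height_same_or_gt (Q i) J d) => // [u /JQ //|/lQ //].
have [|i Ai|G G0 QG] := @codim_ge_bigcap _ A (fun i u => u \in Q i) d.+1 _ _ m' r ltn.
- by move=> i; apply: idealr_ideal_pred.
- by apply: codim_ge_primary; [apply: Qprim|apply: AP].
exists G => //; apply/JQ => i; have := QG i; rewrite /A.
case: excluded_middle_informative => [lQi _|_ /(_ isT) Gi] /=; first exact: idealMr.
by rewrite mulrC; apply: idealMr.
Qed.

(** Membership in the unmixed part supplies a primary decomposition; each component contains [J],
    hence has height at least [d]. *)
Lemma height_codim l : unmixed_part J l -> codim_ge (fun u => u \in J) d.
Proof.
case=> m [Q [[Qprim JQ] _]] m' r ltn.
have [|i _|G G0 QG] := @codim_ge_bigcap _ xpredT (fun i u => u \in Q i) d _ _ m' r ltn.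
- by move=> i; apply: idealr_ideal_pred.
- apply: codim_ge_primary; first exact: Qprim.
  by move=> P sQP; case: htJ => htJd _; apply: htJd => u /JQ /(_ i) /sQP.
by exists G => //; apply/JQ => i; apply: QG.
Qed.

End UnmixedPart.
End Heights.

(** * Greatest common divisors of polynomials *)

Section PolyIdeal.
Variable A : comNzRingType.
Implicit Types (I : A -> Prop) (f g : {poly A}).

Definition poly_ideal I f := forall i, I f`_i.

Lemma poly_ideal_pred I : ideal_pred I -> ideal_pred (poly_ideal I).
Proof.
move=> idI; split=> [i|f g If Ig i|f g Ig i].
- by rewrite coef0; apply: ideal_pred0.
- by rewrite coefD; apply: ideal_predD.
- by rewrite coefM; apply: ideal_pred_sum => // j _; apply: ideal_predM.
Qed.

Lemma poly_idealZ I c f : ideal_pred I -> I c -> poly_ideal I (c *: f).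
Proof. by move=> idI Ic i; rewrite coefZ; apply: ideal_predMr. Qed.

(* McCoy's theorem for [A / I]: a zero divisor of [(A / I)[X]] is killed by a
   nonzero constant. *)
Lemma nonzerodivisor_poly_mod I f : ideal_pred I ->
  (forall u, (forall i, I (f`_i * u)) -> I u) ->
  nonzerodivisor_mod (poly_ideal I) f.
Proof.
move=> idI primf g; have idIX := poly_ideal_pred idI.
have [m] := ubnP (size g); elim: m g => // m IH g ltgm Ifg.
(* Inside the induction on the size of [g], a descending induction on [i]. *)
suff If_g i : poly_ideal I (f`_i *: g).
  by move=> j; apply: primf => i; have := If_g i j; rewrite coefZ.
have [t] := ubnP (size f - i); elim: t i => // t IHt i lt_it.
have [lefi|ltif] := leqP (size f) i.
  by rewrite nth_default // scale0r; apply: ideal_pred0 idIX.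
have [->|g0] := eqVneq g 0; first by rewrite scaler0; apply: ideal_pred0 idIX.
have [n szg] : exists n, size g = n.+1.
  by exists (size g).-1; rewrite prednK // lt0n size_poly_eq0.
(* In the coefficient of [f * g] of index [i + n], the terms beyond [i] are in [I] by the inner
   induction, and those before [i] meet a zero coefficient of [g]. *)
have Ilead : I (f`_i * g`_n).
  have := Ifg (i + n)%N; rewrite coefM.
  have lti : (i < (i + n).+1)%N by lia.
  rewrite (bigD1 (Ordinal lti)) //= addKn => Isum.
  rewrite -[_ * _](addrK (\sum_(j < (i + n).+1 | j != Ordinal lti) f`_j * g`_(i + n - j))).
  apply: ideal_predB => //; apply: ideal_pred_sum => // j; rewrite -val_eqE /= => neq_ji.
  have [ltij|] := ltnP i j.
    by have := IHt j _ (i + n - j)%N; rewrite coefZ; apply; lia.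
  rewrite leq_eqVlt (negPf neq_ji) /= => ltji.
  by rewrite [g`__]nth_default ?mulr0; [apply: ideal_pred0|rewrite szg; lia].
rewrite -[g](subrK (g`_n *: 'X^n)) scalerDr; apply: (ideal_predD idIX).
  apply: IH.
    apply: leq_ltn_trans (size_scale_leq _ _) _.
    have : (size (g - g`_n *: 'X^n)%R <= n)%N; last by move/leq_ltn_trans; apply; rewrite szg in ltgm.
    apply/leq_sizeP => j lenj; rewrite coefB coefZ coefXn.
    have [->|neq_jn] := eqVneq j n; first by rewrite mulr1 subrr.
    by rewrite mulr0 subr0 nth_default // szg; lia.
  rewrite scalerBr mulrBr; apply: (ideal_predB idIX).
    by rewrite -scalerAr -mul_polyC; apply: (ideal_predM idIX).
  by rewrite scalerA; apply: (ideal_predM idIX); apply: poly_idealZ.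
by rewrite scalerA; apply: poly_idealZ.
Qed.

End PolyIdeal.

Section Divisibility.
Variable A : comNzRingType.
Implicit Types s u a b g : A.

Definition divides s u := exists q, u = q * s.

Lemma divides_ideal_pred s : ideal_pred (divides s).
Proof.
split=> [|u v [p ->] [q ->]|a u [q ->]]; first by exists 0; rewrite mul0r.
  by exists (p + q); rewrite mulrDl.
by exists (a * q); rewrite mulrA.
Qed.

(* Over a domain: [a] and [b] form a regular sequence, or generate the unit
   ideal. *)
Definition strongly_coprime a b :=
  forall s u, divides s (a * u) -> divides s (b * u) -> divides s u.

Definition has_gcd_property := forall a b, exists g a' b',
  [/\ a = a' * g, b = b' * g & strongly_coprime a' b'].

(** The hypothesis of McCoy's theorem modulo every principal ideal at once. *)
Definition primitive_poly (f : {poly A}) :=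
  forall s u, (forall i, divides s (f`_i * u)) -> divides s u.

Lemma strongly_coprime1l b : strongly_coprime 1 b.
Proof. by move=> s u; rewrite mul1r. Qed.

Lemma strongly_coprime1r a : strongly_coprime a 1.
Proof. by move=> s u _; rewrite mul1r. Qed.

(** The content is an iterated gcd, built coefficient by coefficient. *)
Lemma poly_content (f : {poly A}) : has_gcd_property ->
  exists c f', f = c *: f' /\ primitive_poly f'.
Proof.
move=> gcdA; elim/poly_ind: f => [|f a [c [f' [-> primf']]]].
  exists 0, 1; rewrite scale0r; split=> // s u /(_ 0%N).
  by rewrite coef1 mul1r.
have [g [c' [a' [-> -> cop]]]] := gcdA c a.
exists g, (c' *: f' * 'X + a'%:P); split.
  by rewrite scalerDr scalerAl scalerA [c' * g]mulrC [a' * g]mulrC polyCM mul_polyC.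
move=> s u sf; apply: cop; last first.
  by have := sf 0%N; rewrite coefD coefMX coefC add0r.
apply: primf' => i; have := sf i.+1; rewrite coefD coefMX coefC /= addr0 coefZ.
by rewrite mulrCA mulrA.
Qed.

Lemma poly_ideal_divides s (f : {poly A}) :
  poly_ideal (divides s) f -> exists q, f = s *: q.
Proof.
elim/poly_ind: f => [|f a IH] sf; first by exists 0; rewrite scaler0.
have [i|q ->] := IH; first by have := sf i.+1; rewrite coefD coefMX coefC addr0.
have [b ->] : divides s a by have := sf 0%N; rewrite coefD coefMX coefC add0r.
by exists (q * 'X + b%:P); rewrite scalerDr scalerAl [b * s]mulrC polyCM mul_polyC.
Qed.

(** A form of Gauss's lemma: by McCoy's theorem, [f] is a nonzerodivisor modulo the extension of the
    ideal of [s]. *)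
Lemma primitive_poly_dvdl s (f g h : {poly A}) :
  primitive_poly f -> f * g = s *: h -> exists q, g = s *: q.
Proof.
move=> primf fg; apply: poly_ideal_divides.
apply: (nonzerodivisor_poly_mod (f := f)) => [|u|]; first exact: divides_ideal_pred.
  exact: primf.
by move=> i; rewrite fg coefZ; exists h`_i; rewrite mulrC.
Qed.

End Divisibility.

Section GaussLemma.
Variable A : idomainType.

Lemma scale_polyI (d : A) (p q : {poly A}) : d != 0 -> d *: p = d *: q -> p = q.
Proof. by move=> d0; rewrite -!mul_polyC => /mulfI; apply; rewrite polyC_eq0. Qed.

(** The gcd is the primitive part [h] of the gcd over the fraction field, times the common content
    of the cofactors. Bezout controls the cofactors up to a constant [d], which Gauss's lemma
    removes. *)
Lemma poly_has_gcd_property :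
  has_gcd_property A -> has_gcd_property {poly A}.
Proof.
move=> gcdA a b; pose h0 := gcdp a b.
have [h00|h0N0] := eqVneq h0 0.
  move/eqP: h00; rewrite Pdiv.Idomain.gcdp_eq0 => /andP[/eqP -> /eqP ->].
  by exists 0, 1, 0; rewrite !mulr0; split=> //; apply: strongly_coprime1l.
have [c [h [h0E primh]]] := poly_content h0 gcdA.
have cN0 : c != 0 by apply: contraNneq h0N0 => c0; rewrite h0E c0 scale0r.
have hN0 : h != 0 by apply: contraNneq h0N0 => hh; rewrite h0E hh scaler0.
(* Pseudo-division leaves a scalar [d]; Gauss's lemma for the primitive [h] divides it out. *)
have h_dvd f : h0 %| f -> exists f1, f = f1 * h.
  case/Pdiv.Idomain.dvdpP => -[d q0] /= dN0 fE.
  have [q qE] : exists q, c *: q0 = d *: q.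
    apply: (primitive_poly_dvdl (h := f) primh).
    by rewrite fE h0E -scalerAr mulrC -scalerAr.
  exists q; apply: (scale_polyI dN0); rewrite fE scalerAl -qE h0E.
  by rewrite -scalerAr scalerAl.
have [a1 aE] := h_dvd a (Pdiv.Idomain.dvdp_gcdl a b); have [b1 bE] := h_dvd b (Pdiv.Idomain.dvdp_gcdr a b).
have [d [p [q [dN0 bez]]]] : exists d p q, d != 0 /\ p * a1 + q * b1 = d%:P.
  have [[u v] /= /Pdiv.Idomain.eqpP[[c1 c2] /= /andP[c1N0 c2N0] uv]] := Pdiv.Idomain.Bezoutp a b.
  exists (c2 * c), (c1 *: u), (c1 *: v); split; first by rewrite mulf_neq0.
  apply: (mulIf hN0); rewrite mulrDl -!scalerAl -!mulrA -aE -bE -scalerDr uv.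
  by rewrite -/h0 h0E scalerA mul_polyC.
(* Shifting [b1] past the size of [a1] packs both cofactors into one polynomial, whose content is
   their common content. *)
pose N := size a1.
have [c' [f [fE primf]]] := poly_content (a1 + b1 * 'X^N) gcdA.
have [a2 [b2 [a1E b1E f2E]]] : exists a2 b2,
    [/\ a1 = c' *: a2, b1 = c' *: b2 & f = a2 + b2 * 'X^N].
  exists (take_poly N f), (drop_poly N f); rewrite poly_take_drop; split=> //.
    by rewrite -take_polyZ -fE take_polyDMXn.
  by rewrite -drop_polyZ -fE drop_polyDMXn.
exists (c' *: h), a2, b2; split.
- by rewrite aE a1E -scalerAl scalerAr.
- by rewrite bE b1E -scalerAl scalerAr.
move=> s v [x xE] [y yE].
have dv : d *: v = (p * (c' *: x) + q * (c' *: y)) * s.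
  rewrite -mul_polyC -bez a1E b1E -!mul_polyC.
  transitivity (p * (c'%:P * (a2 * v)) + q * (c'%:P * (b2 * v))); first by ring.
  by rewrite xE yE; ring.
have fv : f * v = (x + y * 'X^N) * s by rewrite f2E mulrDl xE mulrAC yE; ring.
have [s0|sN0] := eqVneq s 0.
  exists 0; rewrite mul0r; apply: (scale_polyI dN0).
  by rewrite dv s0 mulr0 scaler0.
move: dv; set z := _ + _ => dv.
(* Cancelling [s] gives [f * z = d *: (x + y * 'X^N)], to which Gauss's lemma applies. *)
have [z' zE] : exists z', z = d *: z'.
  apply: (primitive_poly_dvdl (h := x + y * 'X^N) primf).
  by apply: (mulIf sN0); rewrite -mulrA -dv -scalerAl -fv -scalerAr.
by exists z'; apply: (scale_polyI dN0); rewrite dv zE -scalerAl.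
Qed.

End GaussLemma.

Lemma mpoly0_const (k : fieldType) (p : {mpoly k[0]}) : p = (p@_0%MM)%:MP.
Proof.
apply/mpolyP => m; have -> : m = 0%MM by apply/mnmP => -[].
by rewrite mcoeffC eqxx mulr1.
Qed.

Lemma mpoly_has_gcd_property (k : fieldType) (n : nat) :
  has_gcd_property {mpoly k[n]}.
Proof.
elim: n => [|n IH] a b.
  have [->|aN0] := eqVneq a 0.
    by exists b, 0, 1; rewrite mul0r mul1r; split=> //; apply: strongly_coprime1r.
  exists a, 1, ((b@_0%MM / a@_0%MM)%:MP); rewrite mul1r; split=> //; last first.
    exact: strongly_coprime1l.
  rewrite {1}(mpoly0_const b) {2}(mpoly0_const a) -mpolyCM divfK //.
  by apply: contraNneq aN0 => a0; rewrite (mpoly0_const a) a0.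
pose nu : {rmorphism _ -> _} := @split_poly k n (fun=> 0%N) ord0.
pose nu' : {rmorphism _ -> _} := @join_poly k n (fun=> 0%N) ord0.
have nuK : cancel nu nu' := split_polyK _ _.
have nu'K : cancel nu' nu := join_polyK _ _.
have [g [a' [b' [aE bE cop]]]] := poly_has_gcd_property IH (nu a) (nu b).
exists (nu' g), (nu' a'), (nu' b'); split.
- by rewrite -[LHS]nuK aE rmorphM.
- by rewrite -[LHS]nuK bE rmorphM.
have nu_dvd c s u : divides s (nu' c * u) -> divides (nu s) (c * nu u).
  by move=> [q /(congr1 nu)]; rewrite !rmorphM /= nu'K; exists (nu q).
move=> s u /nu_dvd sa /nu_dvd sb; have [q qE] := cop _ _ sa sb.
by exists (nu' q); rewrite -[LHS]nuK qE rmorphM /= nuK.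
Qed.

(** * Regular sequences *)

(** If [a] is nonzero, [a] and [b] form a regular sequence. If [a] is zero, coprimality at [s = b]
    and [u = 1] makes [b] a unit. *)
Lemma codim_ge_strongly_coprime (k : fieldType) (n : nat) (a b : {mpoly k[n]}) :
  strongly_coprime a b -> codim_ge (fun u => exists c d, u = c * a + d * b) 2.
Proof.
move=> cop; pose I' := ideal_add (ideal_add (fun u : {mpoly k[n]} => u = 0) a) b.
have I'E u : I' u -> exists c d, u = c * a + d * b.
  by move=> [d [c /eqP]]; rewrite subr_eq0 subr_eq => /eqP ->; exists c, d.
have idI1 := ideal_add_pred a (zero_ideal_pred {mpoly k[n]}).
have idI2 := ideal_add_pred b idI1.
have [a0|aN0] := eqVneq a 0.
  have [||q qb] := cop b 1; first by exists 0; rewrite a0 !mul0r.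
    by exists 1; rewrite mulrC.
  by move=> m r _; exists 1; rewrite ?oner_neq0 // rmorph1; exists 0, q; rewrite mul0r add0r.
suff codI' : codim_ge I' 2.
  by move=> m r ltn; have [G G0 /I'E IG] := codI' m r ltn; exists G.
have I1E u : ideal_add (fun u => u = 0) a u <-> divides a u.
  split=> [[q /eqP]|[q ->]]; first by rewrite subr_eq0 => /eqP ->; exists q.
  by exists q; rewrite subrr.
apply: (codim_ge_step (f := b) (I := ideal_add (fun u => u = 0) a)) => //.
- by move=> u Iu; exists 0; rewrite mul0r subr0.
- by exists 1; rewrite mul1r subrr; apply: ideal_pred0.
- by move=> u /I1E bu; apply/I1E; apply: cop => //; exists u; rewrite mulrC.
apply: (codim_ge_step (f := a) (I := fun u => u = 0)) => //.
- by move=> u ->; apply: ideal_pred0.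
- by exists 1; rewrite mul1r subrr.
- by move=> u /eqP; rewrite mulf_eq0 (negPf aN0) => /eqP.
exact: codim_ge0.
Qed.

Section RegularSequences.

Lemma regular_seq_iff (R : comNzRingType) (I I' : R -> Prop) s :
  (forall u, I u <-> I' u) -> regular_seq I s -> regular_seq I' s.
Proof.
elim: s I I' => //= x s IH I I' II' [regx regs]; split=> [u /II' /regx /II' //|].
by apply: IH regs => u; split=> -[a /II' Ia]; exists a.
Qed.

Lemma regular_seq_iso (R S : comNzRingType) (phi : {rmorphism S -> R})
    (psi : {rmorphism R -> S}) (I : S -> Prop) s :
  cancel phi psi -> cancel psi phi ->
  regular_seq I s -> regular_seq (fun u => I (psi u)) (map phi s).
Proof.
move=> phiK psiK; elim: s I => //= x s IH I [regx regs]; split=> [u|].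
  by rewrite rmorphM /= phiK => /regx.
apply: regular_seq_iff (IH _ regs) => u; split=> -[a Ia].
  by exists (phi a); rewrite rmorphB rmorphM /= !phiK.
by exists (psi a); rewrite rmorphB rmorphM /= !phiK in Ia.
Qed.

Lemma ideal_add_polyC (A : comNzRingType) (I : A -> Prop) x (f : {poly A}) :
  ideal_pred I ->
  poly_ideal (ideal_add I x) f <-> ideal_add (poly_ideal I) x%:P f.
Proof.
move=> idI; split=> [If|[q Iq] i]; last first.
  by exists q`_i; have := Iq i; rewrite coefB coefMC.
pose q := \poly_(i < size f) sval (constructive_indefinite_description _ (If i)).
exists q => i; rewrite coefB coefMC coef_poly; case: ltnP => [_|lesz].
  by case: constructive_indefinite_description.
by rewrite nth_default // mul0r subrr; apply: ideal_pred0.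
Qed.

(** Regularity of [s] extends coefficientwise; by McCoy's theorem, the unit coefficient makes [f] a
    nonzerodivisor modulo any extended ideal. *)
Lemma regular_seq_poly (A : comNzRingType) (I : A -> Prop) s (f : {poly A}) e u :
  ideal_pred I -> f`_e * u = 1 ->
  regular_seq I s -> regular_seq (poly_ideal I) (rcons (map polyC s) f).
Proof.
move=> idI fe; elim: s I idI => [|x s IH] I idI /=.
  move=> _; split=> //; apply: nonzerodivisor_poly_mod => // v /(_ e) Iv.
  by rewrite -[v]mul1r -fe mulrAC; apply: ideal_predMr.
case=> regx regs; split=> [g Ig i|].
  by apply: regx; have := Ig i; rewrite coefCM.
apply: regular_seq_iff (IH _ (ideal_add_pred x idI) regs) => g.
exact: ideal_add_polyC.
Qed.

Lemma regular_seq_nseq1 (R : comNzRingType) (I : R -> Prop) d :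
  regular_seq I (nseq d 1).
Proof. by elim: d I => //= d IH I; split=> [u|]; rewrite ?mul1r. Qed.

End RegularSequences.

(** * Nagata's change of variables *)

Section NagataTrick.

Lemma digits_inj N n (a b : 'I_n -> nat) :
  (forall i, a i < N)%N -> (forall i, b i < N)%N ->
  (\sum_(i < n) a i * N ^ i = \sum_(i < n) b i * N ^ i)%N -> a =1 b.
Proof.
elim: n a b => [|n IH] a b lta ltb; first by move=> _ [].
have step (c : 'I_n.+1 -> nat) : (\sum_(i < n.+1) c i * N ^ i
    = (\sum_(i < n) c (lift ord0 i) * N ^ i) * N + c ord0)%N.
  rewrite big_ord_recl expn0 muln1 addnC big_distrl /=; congr (_ + _)%N.
  by apply: eq_bigr => i _; rewrite expnSr mulnA.
rewrite !step => eqab.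
have N0 : (0 < N)%N by apply: leq_trans (lta ord0).
have eq0 : a ord0 = b ord0.
  by have := congr1 (modn^~ N) eqab; rewrite /= !modnMDl !modn_small.
move: eqab; rewrite eq0 => /addIn /eqP; rewrite eqn_pmul2r // => /eqP eqab i.
case: (unliftP ord0 i) => [i'|] -> //.
exact: (IH (fun i => a (lift ord0 i)) (fun i => b (lift ord0 i))).
Qed.

Variables (k : fieldType) (n : nat).

(** The degree in ['X] of the sheared monomial, with its exponents read as digits in base [N]. *)
Definition nagata_weight N (m : 'X_{1..n.+1}) : nat := (\sum_(i < n.+1) m i * N ^ i)%N.

Lemma split_poly_monomial N (m : 'X_{1..n.+1}) : (0 < N)%N ->
  let M := split_poly (fun i : 'I_n => N ^ i.+1)%N ord0 ('X_[m] : {mpoly k[n.+1]}) in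
  M \is monic /\ size M = (nagata_weight N m).+1.
Proof.
move=> N0 M; pose w (i : 'I_n) := (N ^ i.+1)%N.
have varP (i : 'I_n.+1) : split_var k w ord0 i \is monic /\
    size (split_var k w ord0 i) = (N ^ i).+1.
  rewrite /split_var; case: unliftP => [i'|] ->; last first.
    by rewrite monicX size_polyX.
  have lt1 : (size ('X_i' : {mpoly k[n]})%:P < size ('X^(w i') : {poly {mpoly k[n]}}))%N.
    rewrite size_polyXn; apply: leq_ltn_trans (size_polyC_leq1 _) _.
    by rewrite ltnS expn_gt0 N0.
  rewrite addrC; split; last by rewrite size_polyDl // size_polyXn.
  by rewrite monicE lead_coefDl // lead_coefXn.
have ME : M = \prod_i split_var k w ord0 i ^+ m i by rewrite /M /split_poly mmapX.
have monP i : split_var k w ord0 i ^+ m i \is monic by rewrite monic_exp ?(varP i).1.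
split; first by rewrite ME; apply: monic_prod => i _; apply: monP.
rewrite ME size_prod => [|i _]; last by rewrite monic_neq0.
have szi i : size (split_var k w ord0 i ^+ m i) = (m i * N ^ i).+1.
  have /prednK <- : (0 < size (split_var k w ord0 i ^+ m i))%N.
    by rewrite lt0n size_poly_eq0 monic_neq0.
  by rewrite size_exp (varP i).2 mulnC.
rewrite (eq_bigr (fun i : 'I_n.+1 => m i * N ^ i + 1)%N) => [|i _]; last by rewrite szi addn1.
by rewrite big_split /= sum1_card subSn ?leq_addl // addnK.
Qed.

(** With [N] above every exponent of [f], distinct monomials of [f] have distinct weights, so the
    heaviest one alone contributes to the coefficient at its weight, which is a constant. *)
Lemma nagata (f : {mpoly k[n.+1]}) : f != 0 ->
  exists w e c, c != 0 /\ (split_poly w ord0 f)`_e = c%:MP.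
Proof.
move=> f0; pose N := (msize f).+1.
have ltN m : m \in msupp f -> forall i, (m i < N)%N.
  move=> /msize_mdeg_lt ltm i; rewrite /N ltnS; apply: leq_trans (ltnW ltm).
  by rewrite mdegE (bigD1 i) //= leq_addr.
have [m mf maxm] : exists2 m, m \in msupp f &
    forall m', m' \in msupp f -> (nagata_weight N m' <= nagata_weight N m)%N.
  have [m0 m0f] : exists m, m \in msupp f by exists (mlead f); apply: mlead_supp.
  case: (@arg_maxnP (seq_sub (msupp f)) (SeqSub m0f) xpredT
    (fun m => nagata_weight N (ssval m))) => // m _ maxm.
  by exists (ssval m) => [|m' m'f]; [apply: ssvalP|apply: (maxm (SeqSub m'f))].
exists (fun i : 'I_n => N ^ i.+1)%N, (nagata_weight N m), f@_m.
split; first by rewrite -mcoeff_msupp.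
rewrite {1}[f]mpolyE raddf_sum coef_sum (bigD1_seq m) //= big_seq_cond big1 ?addr0.
  have [monM szM] := split_poly_monomial m (ltn0Sn (msize f)).
  rewrite -mul_mpolyC rmorphM /= split_polyC coefCM.
  by have := monicP monM; rewrite lead_coefE szM /= => ->; rewrite mulr1.
move=> m' /andP[m'f neq]; have [_ szM] := split_poly_monomial m' (ltn0Sn (msize f)).
rewrite -mul_mpolyC rmorphM /= split_polyC coefCM nth_default ?mulr0 // szM.
rewrite ltn_neqAle maxm // andbT; apply: contra neq => /eqP eqw.
by apply/eqP/mnmP; apply: (@digits_inj N); [apply: ltN|apply: ltN|].
Qed.

End NagataTrick.

(* By Nagata's trick, in suitable coordinates the ideal contains a polynomial
   that is monic in one variable: it prolongs any regular sequence in the other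
   variables. *)
Lemma codim_ge_regular_seq (k : fieldType) (n d : nat) (I : {mpoly k[n]} -> Prop) :
  ideal_pred I -> codim_ge I d ->
  exists s, [/\ size s = d, forall x, x \in s -> I x & regular_seq (fun u => u = 0) s].
Proof.
elim: n d I => [|n IH] [|d] I idI codI; try by exists [::].
  (* Without variables, the empty family yields a nonzero constant in [I], which is then the unit
     ideal. *)
  have [//|G G0 IG] := codI 0%N (fun=> 0).
  suff I1 : I 1.
    exists (nseq d.+1 1); split; rewrite ?size_nseq //; last exact: regular_seq_nseq1.
    by move=> x /nseqP[->].
  move: IG; rewrite [G]mpoly0_const mmapC.
  move/(ideal_predM idI ((G@_0%MM)^-1)%:MP); rewrite -mpolyCM mulVf ?mpolyC1 //.
  by apply: contraNneq G0 => c0; rewrite [G]mpoly0_const c0.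
have [|f f0 If] := codI n.+1 (fun i => 'X_i); first by lia.
have {}If : I f.
  have <- // : peval (fun i => 'X_i) f = f.
  apply: (mpoly_morph_ext (phi := peval (fun i => 'X_i)) (psi := idfun)) => [c|i] /=.
    by rewrite mmapC.
  by rewrite mmapX mmap1U.
have [w [e [c [c0 fe]]]] := nagata f0.
(* The contraction of [I] to the remaining sheared coordinates: with one variable fewer, it
   satisfies the condition for [d] instead of [d.+1]. *)
pose I' a := I (join_coef w ord0 a).
have idI' : ideal_pred I'.
  split=> [|a b|a b]; rewrite /I' ?rmorph0 ?rmorphD ?rmorphM /=; first exact: ideal_pred0.
    exact: ideal_predD.
  exact: ideal_predM.
have [|s [szs Is regs]] := IH d I' idI'.
  move=> m r ltn.
  have [|G G0 IG] := codI m (fun i => join_coef w ord0 (r i)); first by lia.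
  exists G => //; rewrite /I'; move: IG; congr I.
  apply: (mpoly_morph_ext (phi := peval _) (psi := join_coef w ord0 \o peval r)) => [a|i] /=.
    by rewrite !mmapC join_coefC.
  by rewrite !mmapX !mmap1U.
pose phi : {rmorphism _ -> _} := join_poly w (ord0 : 'I_n.+1) : {poly {mpoly k[n]}} -> _.
pose psi : {rmorphism _ -> _} := split_poly w (ord0 : 'I_n.+1) : {mpoly k[n.+1]} -> _.
have phiK : cancel phi psi := join_polyK w ord0.
have psiK : cancel psi phi := split_polyK w ord0.
exists (map phi (rcons (map polyC s) (psi f))); split.
- by rewrite size_map size_rcons size_map szs.
- move=> x /mapP[y]; rewrite mem_rcons inE => /orP[/eqP->|/mapP[a /Is Ia ->]] ->.
    by rewrite psiK.
  by rewrite /phi /= join_polyC.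
have inv : (psi f)`_e * (c^-1)%:MP = 1 by rewrite fe -mpolyCM divff ?mpolyC1.
have := regular_seq_poly (zero_ideal_pred _) inv regs.
move/(regular_seq_iso phiK psiK); apply: regular_seq_iff => u; split=> [u0|->].
  by apply: (can_inj psiK); rewrite rmorph0; apply/polyP => i; rewrite u0 coef0.
by rewrite rmorph0 => i; rewrite coef0.
Qed.

(** * Linear forms *)

Section LinearForm.
Variables (k : fieldType) (n : nat).

Lemma linear_form_gt0 (l : {mpoly k[n]}) : linear_form l -> (0 < n)%N.
Proof.
case=> l0 /dhomogP hl; have /hl /eqP := mlead_supp l0.
by case: (n) (mlead l) => // m; rewrite /= mdegE big_ord0.
Qed.

Lemma linear_formE (l : {mpoly k[n]}) :
  linear_form l -> l = \sum_i l@_(U_(i)) *: 'X_i.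
Proof.
case=> l0 /dhomogP hl; apply/mpolyP => m; rewrite raddf_sum /=.
have [/mdeg1P[i /eqP ->]|mN1] := boolP (mdeg m == 1%N).
  rewrite (bigD1 i) //= mcoeffZ mcoeffX eqxx mulr1 big1 ?addr0 // => j neq_ji.
  rewrite mcoeffZ mcoeffX; case: eqP => [/mnmP/(_ j)|]; last by rewrite mulr0.
  by rewrite !mnm1E eqxx eq_sym (negPf neq_ji).
rewrite memN_msupp_eq0; last by apply: contra mN1 => /hl ->.
rewrite big1 // => i _; rewrite mcoeffZ mcoeffX.
by case: eqP => [mE|]; rewrite ?mulr0 // -mE mdeg1 eqxx in mN1 *.
Qed.

End LinearForm.

(* [k[X_0, .., X_n] / (l)] is a polynomial ring in [n] variables, embedded back
   in [k[X_0, .., X_n]] by [iota]. *)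
Lemma linear_form_retract (k : fieldType) (n : nat) (l : {mpoly k[n.+1]}) :
  linear_form l ->
  exists (eps : {rmorphism {mpoly k[n.+1]} -> {mpoly k[n]}})
         (iota : {rmorphism {mpoly k[n]} -> {mpoly k[n.+1]}}),
  [/\ forall c, eps c%:MP = c%:MP, cancel iota eps, eps l = 0
    & forall u, divides l (u - iota (eps u))].
Proof.
move=> linl; have lE := linear_formE linl; pose c i := l@_(U_(i)).
have [j cj0] : exists j, c j != 0.
  apply: NNPP => nex; case: (linl) => /eqP[]; rewrite lE big1 // => i _.
  by have [->|ci0] := eqVneq l@_(U_(i)) 0; [rewrite scale0r|case: nex; exists i].
(* The solution of [l = 0] for ['X_j]. *)
pose root : {mpoly k[n]} := - \sum_i (c (lift j i) / c j) *: 'X_i.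
pose eps : {rmorphism _ -> _} := mmap (@mpolyC n k)
  (fun i => if unlift j i is Some i' then 'X_i' else root).
pose iota : {rmorphism _ -> _} := mmap (@mpolyC n.+1 k) (fun i => 'X_(lift j i)).
have epsC a : eps a%:MP = a%:MP by rewrite /eps /= mmapC.
have iotaC a : iota a%:MP = a%:MP by rewrite /iota /= mmapC.
have epsXlift i : eps 'X_(lift j i) = 'X_i by rewrite /eps /= mmapX mmap1U liftK.
have epsXj : eps 'X_j = root by rewrite /eps /= mmapX mmap1U unlift_none.
have iotaX i : iota 'X_i = 'X_(lift j i) by rewrite /iota /= mmapX mmap1U.
clearbody eps iota.
have iotaK : cancel iota eps.
  apply: (mpoly_morph_ext (phi := eps \o iota) (psi := idfun)) => [a|i] /=.
    by rewrite iotaC epsC.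
  by rewrite iotaX epsXlift.
have {}lE : l = c j *: ('X_j - iota root).
  rewrite {1}lE (bigD1_ord j) //= scalerBr /root rmorphN scalerN opprK rmorph_sum scaler_sumr.
  congr (_ + _); apply: eq_bigr => i _.
  by rewrite -[_ / _ *: _]mul_mpolyC rmorphM /= iotaC iotaX mul_mpolyC scalerA mulrC divfK.
exists eps, iota; split; [exact: epsC|exact: iotaK| |].
  by rewrite lE -mul_mpolyC rmorphM rmorphB /= iotaK epsXj subrr mulr0.
(* The elements congruent to their retraction modulo [l] form a subring containing the constants and
   the variables. *)
pose P u := divides l (u - iota (eps u)); have idl := divides_ideal_pred l.
have PM u v : P u -> P v -> P (u * v).
  rewrite /P => Pu Pv; have -> : iota (eps (u * v)) = iota (eps u) * iota (eps v).
    by rewrite !rmorphM.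
  move: (iota (eps u)) (iota (eps v)) Pu Pv => u' v' Pu Pv.
  have -> : u * v - u' * v' = u * (v - v') + v' * (u - u') by ring.
  by apply: ideal_predD => //; apply: ideal_predM.
have PD u v : P u -> P v -> P (u + v).
  rewrite /P => Pu Pv; have -> : iota (eps (u + v)) = iota (eps u) + iota (eps v).
    by rewrite !rmorphD.
  move: (iota (eps u)) (iota (eps v)) Pu Pv => u' v' Pu Pv.
  by rewrite opprD addrACA; apply: ideal_predD.
have PC a : P a%:MP by rewrite /P epsC iotaC subrr; apply: ideal_pred0.
have PX i : P 'X_i.
  rewrite /P; case: (unliftP j i) => [i'|] ->.
    by rewrite epsXlift iotaX subrr; apply: ideal_pred0.
  rewrite epsXj; exists ((c j)^-1)%:MP; rewrite {1}lE -mul_mpolyC mulrA -mpolyCM.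
  by rewrite mulVf // mpolyC1 mul1r.
elim/mpolyind => [|a m p _ _ Pp]; first by rewrite -mpolyC0; apply: PC.
apply: PD => //; rewrite -mul_mpolyC; apply: (PM) => //; rewrite mpolyXE_id.
apply: (big_ind P); [by rewrite -mpolyC1|exact: (PM)|move=> i _].
by elim: (m i) => [|e IH]; rewrite ?expr0 -?mpolyC1 // exprS; apply: PM.
Qed.

(** * Acyclicity *)

Section MatrixIdeal.
Variables (R : comNzRingType) (I : R -> Prop).
Hypothesis idI : ideal_pred I.

Definition mx_in m n (A : 'M[R]_(m, n)) := forall i j, I (A i j).

Lemma mx_inD m n (A B : 'M_(m, n)) : mx_in A -> mx_in B -> mx_in (A + B).
Proof. by move=> IA IB i j; rewrite mxE; apply: ideal_predD. Qed.

Lemma mx_inMr m n p (A : 'M_(m, n)) (B : 'M_(n, p)) : mx_in A -> mx_in (A *m B).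
Proof.
by move=> IA i j; rewrite mxE; apply: ideal_pred_sum => // l _; apply: ideal_predMr.
Qed.

Lemma mx_in_nzd x m n (A : 'M_(m, n)) :
  nonzerodivisor_mod I x -> mx_in (x *: A) -> mx_in A.
Proof. by move=> regx IxA i j; apply: regx; have := IxA i j; rewrite mxE. Qed.

End MatrixIdeal.

Lemma mx_in_ideal_add (R : comNzRingType) (I : R -> Prop) x m n (A : 'M[R]_(m, n)) :
  mx_in (ideal_add I x) A -> exists B, mx_in I (A - x *: B).
Proof.
move=> IA; pose B i j := sval (constructive_indefinite_description _ (IA i j)).
exists (\matrix_(i, j) B i j) => i j; rewrite !mxE mulrC /B.
by case: constructive_indefinite_description.
Qed.

Section Acyclicity.
Variables (R : comNzRingType) (a b c d p : nat).
Variables (D3 : 'M[R]_(a, b)) (D2 : 'M[R]_(b, c)) (D1 : 'M[R]_(c, d)).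
Implicit Types (I : R -> Prop).

(** The matrices act on row vectors from the right. The homotopy identities are imposed at every
    term but the last, where no exactness is claimed. *)
Definition null_homotopic x :=
  exists (h2 : 'M[R]_(b, a)) (h1 : 'M[R]_(c, b)) (h0 : 'M[R]_(d, c)),
  [/\ x%:M = D3 *m h2, x%:M = D2 *m h1 + h2 *m D3 & x%:M = D1 *m h0 + h1 *m D2].

Lemma acyclic_left I x (v : 'M_(p, a)) : ideal_pred I ->
  null_homotopic x -> nonzerodivisor_mod I x -> mx_in I (v *m D3) -> mx_in I v.
Proof.
move=> idI [h2 [h1 [h0 [e3 _ _]]]] regx Iv; apply: (mx_in_nzd regx).
by rewrite -mul_mx_scalar e3 mulmxA; apply: mx_inMr.
Qed.

(** By the homotopy for [x], [v *m h2 *m D3] vanishes modulo [I] and [x]. There [acyclic_left] with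
    [y] makes [v *m h2] a multiple of [x] modulo [I], and [x] cancels. *)
Lemma acyclic_middle I x y (v : 'M_(p, b)) : ideal_pred I ->
  null_homotopic x -> null_homotopic y -> nonzerodivisor_mod I x ->
  nonzerodivisor_mod (ideal_add I x) y ->
  mx_in I (v *m D2) -> exists w, mx_in I (v - w *m D3).
Proof.
move=> idI [h2 [h1 [h0 [_ e2 _]]]] nhy regx regy Iv.
have idIx := ideal_add_pred x idI.
have xv : x *: v = v *m D2 *m h1 + v *m h2 *m D3.
  by rewrite -mul_mx_scalar e2 mulmxDr !mulmxA.
have : mx_in (ideal_add I x) (v *m h2).
  apply: (acyclic_left idIx nhy regy) => i j.
  exists (v i j); have := mx_inMr idI h1 Iv i j.
  have -> : v *m D2 *m h1 = x *: v - v *m h2 *m D3 by rewrite xv addrK.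
  by rewrite !mxE => /(ideal_predN idI); rewrite opprB mulrC.
move/mx_in_ideal_add => [w Iw]; exists w; apply: (mx_in_nzd regx).
rewrite scalerBr xv -addrA scalemxAl -mulmxBl.
by apply: mx_inD => //; apply: mx_inMr.
Qed.

Hypothesis D32 : D3 *m D2 = 0.

Lemma acyclic_right I x y z (v : 'M_(p, c)) : ideal_pred I ->
  null_homotopic x -> null_homotopic y -> null_homotopic z ->
  nonzerodivisor_mod I x -> nonzerodivisor_mod (ideal_add I x) y ->
  nonzerodivisor_mod (ideal_add (ideal_add I x) y) z ->
  mx_in I (v *m D1) -> exists w, mx_in I (v - w *m D2).
Proof.
move=> idI [h2 [h1 [h0 [_ _ e1]]]] nhy nhz regx regy regz Iv.
have idIx := ideal_add_pred x idI.
have xv : x *: v = v *m D1 *m h0 + v *m h1 *m D2.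
  by rewrite -mul_mx_scalar e1 mulmxDr !mulmxA.
have [|w] := @acyclic_middle _ y z (v *m h1) idIx nhy nhz regy regz.
  move=> i j; exists (v i j); have := mx_inMr idI h0 Iv i j.
  have -> : v *m D1 *m h0 = x *: v - v *m h1 *m D2 by rewrite xv addrK.
  by rewrite !mxE => /(ideal_predN idI); rewrite opprB mulrC.
move/mx_in_ideal_add => [w' Iw]; exists w'; apply: (mx_in_nzd regx).
rewrite scalerBr xv -addrA scalemxAl -mulmxBl.
apply: mx_inD => //; first exact: mx_inMr.
(* The boundary [w *m D3] may be subtracted since [D2] kills it. *)
have -> : (v *m h1 - x *: w') *m D2 = (v *m h1 - w *m D3 - x *: w') *m D2.
  by rewrite !mulmxBl -[w *m D3 *m D2]mulmxA D32 mulmx0 subr0.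
exact: mx_inMr.
Qed.

End Acyclicity.

(** * Free resolutions of length three *)

Section FreeModules.
Variable R : comNzRingType.

Section Lift.
Variables (n : nat) (M : lmodType R) (m : 'I_n -> M).

Definition row_lift (x : 'rV[R]_n) : M := \sum_i x 0 i *: m i.

Lemma row_lift_is_linear : linear row_lift.
Proof.
move=> c x y; rewrite scaler_sumr -big_split /=; apply: eq_bigr => i _.
by rewrite !mxE scalerDl scalerA.
Qed.
HB.instance Definition _ := GRing.isLinear.Build R 'rV[R]_n M _ row_lift row_lift_is_linear.

End Lift.

Lemma projective_row (n : nat) : projective ('rV[R]_n).
Proof.
move=> M N g f surj.
have /fin_all_exists[m gm] i : exists x, g x = f (delta_mx 0 i) by apply: surj.
exists (row_lift m) => x; rewrite /= [in RHS](row_sum_delta x) raddf_sum linear_sum /=.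
by apply: eq_bigr => i _; rewrite !linearZ /= gm.
Qed.

Section QuotientMap.
Variable J : idealr R.

Definition row_quot (x : 'rV[R]_1) : {ideal_quot J} := \pi_({ideal_quot J}) (x 0 0).

Lemma row_quot_is_linear : linear row_quot.
Proof. by move=> c x y; rewrite /row_quot !mxE rmorphD rmorphM. Qed.
HB.instance Definition _ :=
  GRing.isLinear.Build R 'rV[R]_1 {ideal_quot J} _ row_quot row_quot_is_linear.

Lemma row_quot_eq0 x : row_quot x = 0 <-> x 0 0 \in J.
Proof.
rewrite -[x 0 0 in X in _ <-> X]subr0 Quotient.idealrBE /row_quot -(rmorph0 (\pi_{ideal_quot J})).
by split=> [->|/eqP].
Qed.

End QuotientMap.

Lemma projdim_le3 (J : idealr R) n1 n2 n3 (D0 : 'M[R]_(n1, 1)) (D1 : 'M[R]_(n2, n1))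
    (D2 : 'M[R]_(n3, n2)) :
  (forall x : 'rV_1, x 0 0 \in J <-> exists y, y *m D0 = x) ->
  (forall x : 'rV_n1, x *m D0 = 0 <-> exists y, y *m D1 = x) ->
  (forall x : 'rV_n2, x *m D1 = 0 <-> exists y, y *m D2 = x) ->
  (forall x : 'rV_n3, x *m D2 = 0 -> x = 0) ->
  projdim_le {ideal_quot J} 3.
Proof.
move=> exJ ex0 ex1 ex2.
pose rk i := match i with 0 => 1 | 1 => n1 | 2 => n2 | 3 => n3 | _ => 0 end%N.
pose D i : 'M[R]_(rk i.+1, rk i) :=
  match i return 'M[R]_(rk i.+1, rk i) with
  | 0%N => D0 | 1%N => D1 | 2%N => D2 | _ => 0 end.
exists (fun i => 'rV[R]_(rk i)), (fun i => mulmxr (D i)), (row_quot J); split=> /=.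
- by move=> i; apply: projective_row.
- by do 4!case=> //; move=> i _ x; apply: thinmx0.
- by elim/quotW => u; exists (const_mx u); rewrite /row_quot mxE.
- by move=> x; rewrite row_quot_eq0 exJ.
- case=> [|[|[|i]]] x //=; last by split=> _; [exists 0; rewrite mulmx0 [RHS]thinmx0|rewrite mulmx0].
  split=> [/ex2 ->|[y <-]]; first by exists 0; rewrite mulmx0.
  by rewrite mulmx0 mul0mx.
Qed.

End FreeModules.

(** * The Buchsbaum-Rim complex *)

Ltac mx_entries :=
  apply/matrixP => - [[|[|[|[|?]]]] ?] // [[|[|[|[|?]]]] ?] //;
  rewrite ?mxE ?big_ord_recl ?big_ord0 ?mxE /=.

Section BuchsbaumRim.
Variables (R : comNzRingType) (p0 p1 p2 p3 q0 q1 q2 q3 : R).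

Definition seq_mx m n (s : seq (seq R)) : 'M[R]_(m, n) :=
  \matrix_(i, j) nth 0 (nth [::] s i) j.

(* The Hodge dual of the 2-form with coordinates [mij]. *)
Definition alternating_mx (m01 m02 m03 m12 m13 m23 : R) : 'M[R]_4 :=
  seq_mx 4 4 [:: [:: 0; m23; - m13; m12]; [:: - m23; 0; m03; - m02];
                 [:: m13; - m03; 0; m01]; [:: - m12; m02; - m01; 0]].

Definition row_pair : 'M[R]_(2, 4) :=
  seq_mx 2 4 [:: [:: p0; p1; p2; p3]; [:: q0; q1; q2; q3]].

Definition col_pair : 'M[R]_(4, 2) :=
  seq_mx 4 2 [:: [:: p0; q0]; [:: p1; q1]; [:: p2; q2]; [:: p3; q3]].

Definition minor_mx : 'M[R]_4 :=
  alternating_mx (p0 * q1 - p1 * q0) (p0 * q2 - p2 * q0) (p0 * q3 - p3 * q0)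
                 (p1 * q2 - p2 * q1) (p1 * q3 - p3 * q1) (p2 * q3 - p3 * q2).

Definition minor_ideal (x : R) := exists c01 c02 c03 c12 c13 c23,
  x = c01 * (p0 * q1 - p1 * q0) + c02 * (p0 * q2 - p2 * q0)
    + c03 * (p0 * q3 - p3 * q0) + c12 * (p1 * q2 - p2 * q1)
    + c13 * (p1 * q3 - p3 * q1) + c23 * (p2 * q3 - p3 * q2).

Lemma minor_ideal_pred : ideal_pred minor_ideal.
Proof.
split=> [|x y [c1 [c2 [c3 [c4 [c5 [c6 ->]]]]]] [d1 [d2 [d3 [d4 [d5 [d6 ->]]]]]]|
         x y [c1 [c2 [c3 [c4 [c5 [c6 ->]]]]]]].
- by exists 0, 0, 0, 0, 0, 0; rewrite !mul0r !addr0.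
- by exists (c1 + d1), (c2 + d2), (c3 + d3), (c4 + d4), (c5 + d5), (c6 + d6); ring.
- by exists (x * c1), (x * c2), (x * c3), (x * c4), (x * c5), (x * c6); ring.
Qed.

(** Since [minor_mx] is the Hodge dual of p ^ q, the entries are, up to sign, those of p ^ p ^ q and
    q ^ p ^ q. *)
Lemma row_pair_minor : row_pair *m minor_mx = 0.
Proof. by mx_entries; ring. Qed.

Lemma minor_col_pair : minor_mx *m col_pair = 0.
Proof. by mx_entries; ring. Qed.

(* The homotopies are given by Cramer's rule for each minor. *)
Lemma buchsbaum_rim_homotopy x :
  minor_ideal x -> null_homotopic row_pair minor_mx col_pair x.
Proof.
case=> [c01 [c02 [c03 [c12 [c13 [c23 ->]]]]]].
(* With C the alternating matrix of the [cij], u = C q and v = C p; hence p.u = x, q.v = -x and p.v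
   = q.u = 0. *)
pose u0 := c01 * q1 + c02 * q2 + c03 * q3; pose v0 := c01 * p1 + c02 * p2 + c03 * p3.
pose u1 := c12 * q2 + c13 * q3 - c01 * q0; pose v1 := c12 * p2 + c13 * p3 - c01 * p0.
pose u2 := c23 * q3 - c02 * q0 - c12 * q1; pose v2 := c23 * p3 - c02 * p0 - c12 * p1.
pose u3 := - (c03 * q0 + c13 * q1 + c23 * q2).
pose v3 := - (c03 * p0 + c13 * p1 + c23 * p2).
exists (seq_mx 4 2 [:: [:: u0; - v0]; [:: u1; - v1]; [:: u2; - v2]; [:: u3; - v3]]).
exists (- alternating_mx c01 c02 c03 c12 c13 c23).
exists (seq_mx 2 4 [:: [:: u0; u1; u2; u3]; [:: - v0; - v1; - v2; - v3]]).
split; mx_entries; rewrite /u0 /u1 /u2 /u3 /v0 /v1 /v2 /v3; ring.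
Qed.

(* The complex [0 -> R^2 -> R^4 -> R^4 -> R^2] is the Buchsbaum-Rim complex of
   the 2x4 matrix with rows [p] and [q]. *)
Lemma buchsbaum_rim_exact x1 x2 x3 : minor_ideal x1 -> minor_ideal x2 ->
  minor_ideal x3 -> regular_seq (fun u => u = 0) [:: x1; x2; x3] ->
  [/\ forall v : 'rV_2, v *m row_pair = 0 -> v = 0,
      forall v : 'rV_4, v *m minor_mx = 0 -> exists w, v = w *m row_pair
    & forall v : 'rV_4, v *m col_pair = 0 -> exists w, v = w *m minor_mx].
Proof.
move=> /buchsbaum_rim_homotopy h1 /buchsbaum_rim_homotopy h2 /buchsbaum_rim_homotopy h3.
case=> reg1 [reg2 [reg3 _]]; have id0 := zero_ideal_pred R.
have mx0 m n (A : 'M[R]_(m, n)) : mx_in (fun u => u = 0) A <-> A = 0.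
  split=> [A0|-> i j]; last by rewrite mxE.
  by apply/matrixP => i j; rewrite mxE A0.
split=> v.
- by move/mx0/(acyclic_left id0 h1 reg1)/mx0.
- move/mx0/(acyclic_middle id0 h1 h2 reg1 reg2) => [w /mx0 e].
  by exists w; apply/eqP; rewrite -subr_eq0 e.
- move/mx0/(acyclic_right row_pair_minor id0 h1 h2 h3 reg1 reg2 reg3).
  by move=> [w /mx0 e]; exists w; apply/eqP; rewrite -subr_eq0 e.
Qed.

End BuchsbaumRim.

(** * Three-generated ideals *)

(** Since [g] is a nonzerodivisor modulo [l], a syzygy of the three generators extends by a fourth
    coordinate to a relation among the rows of [col_pair]. This carries exactness over to the
    truncation. *)
Lemma three_generated_projdim (R : idomainType) (J : idealr R)
    (a0 a1 a2 b0 b1 b2 l g x1 x2 x3 : R) :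
  l != 0 -> (forall u, divides l (g * u) -> divides l u) ->
  (forall x, x \in J <-> exists c0 c1 c2, x = c0 * (a0 * l + b0 * g)
     + c1 * (a1 * l + b1 * g) + c2 * (a2 * l + b2 * g)) ->
  minor_ideal a0 a1 a2 (- g) b0 b1 b2 l x1 ->
  minor_ideal a0 a1 a2 (- g) b0 b1 b2 l x2 ->
  minor_ideal a0 a1 a2 (- g) b0 b1 b2 l x3 ->
  regular_seq (fun u => u = 0) [:: x1; x2; x3] ->
  projdim_le {ideal_quot J} 3.
Proof.
move=> l0 lg genJ I1 I2 I3 regx.
have [ex3 ex2 ex1] := buchsbaum_rim_exact I1 I2 I3 regx.
set D3 := row_pair _ _ _ _ _ _ _ _ in ex3 ex2; set D2 := minor_mx _ _ _ _ _ _ _ _ in ex2 ex1.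
set D1 := col_pair _ _ _ _ _ _ _ _ in ex1.
have D32 : D3 *m D2 = 0 := row_pair_minor _ _ _ _ _ _ _ _.
have D21 : D2 *m D1 = 0 := minor_col_pair _ _ _ _ _ _ _ _.
pose pr : 'M[R]_(4, 3) := \matrix_(i, j) (i == j :> nat)%:R.
pose F : 'M[R]_(3, 1) := seq_mx 3 1 [:: [:: a0 * l + b0 * g]; [:: a1 * l + b1 * g];
                                       [:: a2 * l + b2 * g]].
(* The fourth row [(- g, l)] of [D1] pairs to zero with [(l, g)], so forgetting its coordinate is
   compatible with the generators. *)
have prF : pr *m F = D1 *m seq_mx 2 1 [:: [:: l]; [:: g]].
  by mx_entries; ring.
apply: (@projdim_le3 _ J 3 4 2 F (D2 *m pr) D3) => [x|x|x|].
- split=> [/genJ[c0 [c1 [c2 xE]]]|[y <-]].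
    by exists (seq_mx 1 3 [:: [:: c0; c1; c2]]); apply/matrixP => i j;
    by rewrite !ord1 xE !mxE !big_ord_recl big_ord0 !mxE /=; ring.
  apply/genJ; exists (y 0 ord0), (y 0 (lift ord0 ord0)), (y 0 (lift ord0 (lift ord0 ord0))).
  by rewrite !mxE !big_ord_recl big_ord0 !mxE /=; ring.
- split=> [/matrixP/(_ 0 0)|[y <-]]; last first.
    by rewrite -!mulmxA prF (mulmxA D2) D21 mul0mx mulmx0.
  rewrite !mxE !big_ord_recl big_ord0 !mxE /=.
  set y0 := x 0 _; set y1 := x 0 _; set y2 := x 0 _ => syz.
  have [t tE] : divides l (y0 * b0 + y1 * b1 + y2 * b2).
    apply: lg; exists (- (y0 * a0 + y1 * a1 + y2 * a2)).
    by rewrite -[RHS]addr0 -syz; ring.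
  have tE' : y0 * a0 + y1 * a1 + y2 * a2 = - t * g.
    apply: (mulIf l0); rewrite -[RHS]addr0 -syz.
    rewrite -[LHS](addrK (g * (t * l))) -{1}tE; ring.
  have [|y zE] := ex1 (seq_mx 1 4 [:: [:: y0; y1; y2; - t]]).
    by mx_entries; [rewrite -[RHS](subrr (- t * g)) -{1}tE'|
      rewrite -[RHS](subrr (t * l)) -{1}tE]; ring.
  exists y; rewrite mulmxA -zE; mx_entries; rewrite ?mulr1n ?mulr0n ?mulr1 ?mulr0 ?addr0 ?add0r;
    by congr (x _ _); apply: val_inj.
- split=> [|[y <-]]; last by rewrite mulmxA -(mulmxA _ D3) D32 mulmx0 mul0mx.
  rewrite mulmxA => zpr0; suff /ex2[w ->] : x *m D2 = 0 by exists w.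
  have zD1 : x *m D2 *m D1 = 0 by rewrite -mulmxA D21 mulmx0.
  move: (x *m D2) zpr0 zD1 => z zpr0 zD1.
  (* Only the last coordinate of [z] can survive, and the second column of [D1] multiplies it by the
     nonzero [l]. *)
  have z_lt3 (i : 'I_4) : (i < 3)%N -> z 0 i = 0.
    move=> lti; have := congr1 (fun A : 'rV_3 => A 0 (Ordinal lti)) zpr0.
    rewrite [RHS]mxE => <-; rewrite mxE (bigD1 i) //= mxE eqxx mulr1 big1 ?addr0 // => j.
    by rewrite -val_eqE mxE /= => /negPf ->; rewrite mulr0.
  have z3 : z 0 ord_max = 0.
    have := congr1 (fun A : 'rV_2 => A 0 ord_max) zD1.
    rewrite [RHS]mxE mxE big_ord_recr big1 => [|i _] /=.
      by rewrite add0r !mxE /= => /eqP; rewrite mulf_eq0 (negPf l0) orbF => /eqP.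
    by rewrite z_lt3 ?mul0r //= ltn_ord.
  apply/rowP => i; rewrite mxE; have [/z_lt3 //|le3i] := ltnP i 3.
  by have -> : i = ord_max by apply: val_inj; apply/eqP; rewrite eqn_leq le3i -ltnS ltn_ord.
- exact: ex3.
Qed.

(** Codimension 2 in one variable fewer admits the same numbers of elements as codimension 3 here.
    So one family [r] serves the condition on [J] and both coprime pairs, and the three polynomials
    are multiplied. *)
Lemma minor_ideal_codim (k : fieldType) (n : nat) (J : {mpoly k[n.+1]} -> Prop)
    (eps : {rmorphism {mpoly k[n.+1]} -> {mpoly k[n]}})
    (iota : {rmorphism {mpoly k[n]} -> {mpoly k[n.+1]}})
    (l a0 a1 a2 : {mpoly k[n.+1]}) (g b1 b2 c c' : {mpoly k[n]}) :
  (forall a, eps a%:MP = a%:MP) -> (forall u, divides l (u - iota (eps u))) ->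
  l != 0 -> (forall u, divides l (iota g * u) -> divides l u) ->
  strongly_coprime b1 b2 -> strongly_coprime c c' ->
  (forall x, J x -> exists c0 c1 c2, x = c0 * (a0 * l + iota (b1 * c) * iota g)
     + c1 * (a1 * l + iota (b2 * c) * iota g) + c2 * (a2 * l + iota c' * iota g)) ->
  codim_ge (fun s => J (s * l)) 3 ->
  codim_ge (minor_ideal a0 a1 a2 (- iota g) (iota (b1 * c)) (iota (b2 * c)) (iota c') l) 3.
Proof.
move=> epsC kerP l0 lg cop1 cop2 genJ codJ m r ltn.
have epsE G : eps (peval r G) = peval (fun i => eps (r i)) G.
  apply: (mpoly_morph_ext (phi := eps \o peval r) (psi := peval (fun i => eps (r i)))) => [a|i] /=.
    by rewrite !mmapC epsC.
  by rewrite !mmapX !mmap1U.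
have [G1 G10 /genJ] := codJ m r ltn.
have [|G2 G20] := codim_ge_strongly_coprime cop1 (fun i => eps (r i)); first by lia.
have [|G3 G30] := codim_ge_strongly_coprime cop2 (fun i => eps (r i)); first by lia.
rewrite -!epsE => -[e2 [e3 epsG3]] [e0 [e1 epsG2]] [c0 [c1 [c2 sl]]].
exists (G1 * (G2 * G3)); first by rewrite !mulf_neq0.
(* The product of the ideals of the two coprime pairs lies in the ideal of [b1 * c], [b2 * c] and
   [c']. *)
have epss' : eps (peval r (G2 * G3)) = (e0 * b1 + e1 * b2) * (e2 * c + e3 * c').
  by rewrite !rmorphM /= epsG2 epsG3.
have -> : peval r (G1 * (G2 * G3)) = peval r G1 * peval r (G2 * G3) by rewrite rmorphM.
move: (peval r G1) (peval r (G2 * G3)) sl epss' => s s' sl epss'.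
have [t1 t1E] : divides l (c0 * iota (b1 * c) + c1 * iota (b2 * c) + c2 * iota c').
  apply: lg; exists (s - (c0 * a0 + c1 * a1 + c2 * a2)).
  by rewrite [RHS]mulrBl sl; ring.
have sE : s = c0 * a0 + c1 * a1 + c2 * a2 + t1 * iota g.
  apply: (mulIf l0); rewrite sl -[RHS]addr0 -(subrr (t1 * l * iota g)) -{1}t1E.
  by ring.
have [t tE] := kerP s'.
pose d0 := iota (e0 * e2); pose d1 := iota (e1 * e2).
pose d2 := iota ((e0 * b1 + e1 * b2) * e3).
have s'E : s' = d0 * iota (b1 * c) + d1 * iota (b2 * c) + d2 * iota c' + t * l.
  rewrite -[LHS](subrK (iota (eps s'))) tE addrC; congr (_ + _).
  by rewrite epss' /d0 /d1 /d2 -!rmorphM -!rmorphD; congr (iota _); ring.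
move: (iota (b1 * c)) (iota (b2 * c)) (iota c') (iota g) d0 d1 d2 t1E sE s'E.
move=> B0 B1 B2 g' d0 d1 d2 t1E sE s'E.
(* Cauchy-Binet: these are the minors of the coefficient rows [(c0, c1, c2, - t1)] and
   [(d0, d1, d2, t)], which combine the rows [(ai, bi)] and [(- g', l)] to [(s, 0)] and
   [(_, s')]. *)
exists (c0 * d1 - c1 * d0), (c0 * d2 - c2 * d0), (c0 * t + t1 * d0),
  (c1 * d2 - c2 * d1), (c1 * t + t1 * d1), (c2 * t + t1 * d2).
rewrite -[LHS]subr0 -[X in _ - X](mul0r (d0 * a0 + d1 * a1 + d2 * a2 - t * g')).
rewrite -(subrr (t1 * l)) -{1}t1E sE s'E.
by ring.
Qed.

Theorem proposition6 (k : fieldType) (n : nat) (J : idealr {mpoly k[n]})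
    (htJ : has_height J 2)
    (genJ : exists f : 'I_3 -> {mpoly k[n]}, generated_by f J)
    (linJ : exists l : {mpoly k[n]}, linear_form l /\ unmixed_part J l) :
  projdim_le {ideal_quot J} 3.
Proof.
case: linJ => l [linl unml]; have := linear_form_gt0 linl.
case: n => // n in J htJ genJ l linl unml * => _.
have [eps [iota [epsC iotaK epsl kerP]]] := linear_form_retract linl.
have l0 : l != 0 by case: linl.
have [f genf] := genJ; pose f0 := f ord0; pose f1 := f (lift ord0 ord0).
pose f2 := f (lift ord0 (lift ord0 ord0)).
have Jf x : x \in J <-> exists c0 c1 c2, x = c0 * f0 + c1 * f1 + c2 * f2.
  rewrite genf; split=> [[c ->]|[c0 [c1 [c2 ->]]]].
    exists (c ord0), (c (lift ord0 ord0)), (c (lift ord0 (lift ord0 ord0))).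
    by rewrite !big_ord_recl big_ord0 addr0 addrA.
  exists (fun i : 'I_3 => nth 0 [:: c0; c1; c2] i).
  by rewrite !big_ord_recl big_ord0 addr0 addrA.
(* Two gcd steps: modulo [l] the generators become [b1 * c], [b2 * c] and [c'] times [g]. *)
have [g12 [b1 [b2 [ef0 ef1 cop1]]]] := mpoly_has_gcd_property (eps f0) (eps f1).
have [g [c [c' [g12E ef2 cop2]]]] := mpoly_has_gcd_property g12 (eps f2).
have [a0 a0E] := kerP f0; have [a1 a1E] := kerP f1; have [a2 a2E] := kerP f2.
have f0E : f0 = a0 * l + iota (b1 * c) * iota g.
  by rewrite -a0E -rmorphM -mulrA -g12E -ef0 subrK.
have f1E : f1 = a1 * l + iota (b2 * c) * iota g.
  by rewrite -a1E -rmorphM -mulrA -g12E -ef1 subrK.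
have f2E : f2 = a2 * l + iota c' * iota g by rewrite -a2E -rmorphM -ef2 subrK.
(* Otherwise [J] would lie in the ideal of [l], modulo which the [n] elements [iota 'X_i] stay
   algebraically independent, against codimension 2. *)
have g0 : g != 0.
  apply/eqP => g0; rewrite g0 mulr0 in g12E ef2; rewrite g12E !mulr0 in ef0 ef1.
  have [|G /eqP G0 /Jf[d0 [d1 [d2 JG]]]] := height_codim htJ unml (fun i : 'I_n => iota 'X_i).
    by lia.
  case: G0; transitivity (eps (peval (fun i : 'I_n => iota 'X_i) G)); last first.
    by rewrite JG !rmorphD !rmorphM /= ef0 ef1 ef2 !mulr0 !addr0.
  symmetry; move: G {JG}.
  apply: (mpoly_morph_ext (phi := eps \o peval (fun i : 'I_n => iota 'X_i)) (psi := idfun)) => [a|i] /=.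
    by rewrite mmapC epsC.
  by rewrite mmapX mmap1U iotaK.
have lg u : divides l (iota g * u) -> divides l u.
  case=> q /(congr1 eps); rewrite !rmorphM /= iotaK epsl mulr0 => /eqP.
  rewrite mulf_eq0 (negPf g0) /= => /eqP eu.
  by have := kerP u; rewrite eu rmorph0 subr0.
have codI : codim_ge
    (minor_ideal a0 a1 a2 (- iota g) (iota (b1 * c)) (iota (b2 * c)) (iota c') l) 3.
  apply: (minor_ideal_codim (J := fun x => x \in J) epsC) => // [x|].
    by rewrite Jf f0E f1E f2E.
  exact: unmixed_part_codim unml.
have [[|x1 [|x2 [|x3 [|? ?]]]] [//= _ Ix regx]] :=
  codim_ge_regular_seq (minor_ideal_pred _ _ _ _ _ _ _ _) codI.
apply: (three_generated_projdim l0 lg _ (Ix x1 _) (Ix x2 _) (Ix x3 _) regx).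
- by move=> x; rewrite Jf f0E f1E f2E.
- by rewrite !inE eqxx.
- by rewrite !inE eqxx orbT.
- by rewrite !inE eqxx !orbT.
Qed.
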